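(* Let $\mathcal D=\mathcal D_0+Q$ be the one-dimensional discrete Dirac operator on $\mathbf l^2=\ell^2(\mathbb Z)\oplus\ell^2(\mathbb Z)$ with mass $m>0$ and real matrix potential $Q=(q^{ij})_{i,j=1,2}$ satisfying $q^{12}_n=q^{21}_n$ and $q^{21}_n\neq-1$ for all $n\in\mathbb Z$. If $q^{ij}\in\ell^1(\mathbb Z)$ for all $i,j$, then there are no embedded eigenvalues in the continuous spectrum of $\mathcal D$. The reason is that the space of solutions of $\mathcal D\mathbf w=\lambda\mathbf w$ for $\lambda\in(-\sqrt{4+m^2},-m)$, respectively for $\lambda\in(m,\sqrt{4+m^2})$, is spanned by the two fundamental solutions $\tilde{\mathbf w}^{\pm}(\theta)$, respectively $\mathbf w^{\pm}(\theta)$ (the Jost solutions), which are not square summable near $n\to\pm\infty$.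
   Context: Dirac operator: for $\mathbf w=(\mathbf w_n)_{n\in\mathbb Z}$, $\mathbf w_n=(u_n,v_n)\in\mathbb C^2$, $\mathcal D_0=\begin{pmatrix} m& d\\ d^*&-m\end{pmatrix}$, $(du)_n=u_n-u_{n+1}$, $(d^*u)_n=u_n-u_{n-1}$, and $(Q\mathbf w)_n=Q_n\mathbf w_n$ with $Q_n=(q_n^{ij})_{i,j=1,2}$ a real $2\times2$ matrix. The paper describes the continuous spectrum of $\mathcal D$ (in its introduction, under the assumption $\sum_n(1+|n|)^2|q^{ij}_n|<\infty$) as covering $\overline\Gamma$, where $\Gamma=(-\sqrt{m^2+4},-m)\cup(m,\sqrt{m^2+4})$. Jost solutions: let $\theta$ solve $2-2\cos\theta=\lambda^2-m^2$ (for $\lambda\in\Gamma$ it is real, $\theta\in(-\pi,0)\cup(0,\pi)$). For $\operatorname{Re}\lambda\ge0$, $\mathbf w^{\pm}(\theta)$ is the solution of $\mathcal D\mathbf w=\lambda\mathbf w$ with $$\mathbf w^\pm_n(\theta)\to\begin{pmatrix}1\\ \alpha_\pm(\theta)\end{pmatrix}e^{\mp\mathrm i\theta n},\quad n\to\pm\infty,\qquad \alpha_\pm(\theta)=\frac{1-e^{\pm\mathrm i\theta}}{m+\lambda}.$$ For $\operatorname{Re}\lambda\le0$, $\tilde{\mathbf w}^{\pm}(\theta)$ is the solution of $\mathcal D\mathbf w=\lambda\mathbf w$ with $$\tilde{\mathbf w}^\pm_n(\theta)\to\begin{pmatrix}\tilde\alpha_\pm(\theta)\\ 1\end{pmatrix}e^{\mp\mathrm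 i\theta n},\quad n\to\pm\infty,\qquad \tilde\alpha_\pm(\theta)=\frac{1-e^{\mp\mathrm i\theta}}{\lambda-m}.$$
   Formalization: Absence of embedded eigenvalues is stated only for λ in the open bands (−√(m²+4),−m) and (m,√(m²+4)); at the band edges ±m, ±√(m²+4) of the continuous spectrum the claim fails for some ℓ¹ potentials. *)

(* Defs.v *)
(* Stdlib's real numbers, with Coquelicot's series, limits and complex numbers. *)
From Stdlib Require Import Reals ZArith.
From Coquelicot Require Import Coquelicot.
Open Scope R_scope.

Definition spinor : Type := (C * C)%type.
Definition spinor_seq : Type := Z -> spinor.

Definition vadd (x y : spinor) : spinor :=
  ((fst x + fst y)%C, (snd x + snd y)%C).
Definition vsub (x y : spinor) : spinor :=
  ((fst x - fst y)%C, (snd x - snd y)%C).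
Definition vscal (a : C) (x : spinor) : spinor :=
  ((a * fst x)%C, (a * snd x)%C).
Definition vzero : spinor := (RtoC 0, RtoC 0).
Definition vnorm (x : spinor) : R :=
  sqrt (Cmod (fst x) ^ 2 + Cmod (snd x) ^ 2).

(* A series over Z is cut into its two halves; both contain the index 0, which
   does not affect convergence. *)
Definition l1 (f : Z -> R) : Prop :=
  ex_series (fun k : nat => Rabs (f (Z.of_nat k))) /\
  ex_series (fun k : nat => Rabs (f (- Z.of_nat k)%Z)).

Definition l2_near_pinfty (w : spinor_seq) : Prop :=
  ex_series (fun k : nat => vnorm (w (Z.of_nat k)) ^ 2).
Definition l2_near_minfty (w : spinor_seq) : Prop :=
  ex_series (fun k : nat => vnorm (w (- Z.of_nat k)%Z) ^ 2).
Definition l2 (w : spinor_seq) : Prop :=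
  l2_near_pinfty w /\ l2_near_minfty w.

Record potential : Type := mkPotential
  { q11 : Z -> R; q12 : Z -> R; q21 : Z -> R; q22 : Z -> R }.

Definition d (u : Z -> C) (n : Z) : C := (u n - u (n + 1)%Z)%C.
Definition dstar (u : Z -> C) (n : Z) : C := (u n - u (n - 1)%Z)%C.

Definition D0 (m : R) (w : spinor_seq) : spinor_seq := fun n =>
  ((RtoC m * fst (w n) + d (fun k => snd (w k)) n)%C,
   (dstar (fun k => fst (w k)) n - RtoC m * snd (w n))%C).

Definition Qop (q : potential) (w : spinor_seq) : spinor_seq := fun n =>
  ((RtoC (q11 q n) * fst (w n) + RtoC (q12 q n) * snd (w n))%C,
   (RtoC (q21 q n) * fst (w n) + RtoC (q22 q n) * snd (w n))%C).

(* The difference expression acts on all sequences, as the Jost solutions are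
   not in l^2; for a bounded potential it maps l^2 to itself, so the operator
   on l^2 is its restriction. *)
Definition dirac (m : R) (q : potential) (w : spinor_seq) : spinor_seq :=
  fun n => vadd (D0 m w n) (Qop q w n).

Definition solution (m : R) (q : potential) (lam : C) (w : spinor_seq) : Prop :=
  forall n : Z, dirac m q w n = vscal lam (w n).

Definition eigenvalue (m : R) (q : potential) (lam : C) : Prop :=
  exists w : spinor_seq,
    l2 w /\ (exists n : Z, w n <> vzero) /\ solution m q lam w.

(* The open bands. The two band edges on each side are left out: an l^1
   potential can have an eigenvalue there. For instance, with u_n = 1/(1+n^2)
   and v_n = (u_n - u_{n-1})/(2m), the potential whose only nonzero entry is
   q^{11}_n = (v_{n+1} - v_n)/u_n has the eigenvalue m. *)
Definition Gamma_neg (m lam : R) : Prop := - sqrt (m ^ 2 + 4) < lam < - m.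
Definition Gamma_pos (m lam : R) : Prop := m < lam < sqrt (m ^ 2 + 4).
Definition Gamma (m lam : R) : Prop := Gamma_neg m lam \/ Gamma_pos m lam.

Definition quasimomentum (m lam theta : R) : Prop :=
  (- PI < theta < 0 \/ 0 < theta < PI) /\
  2 - 2 * cos theta = lam ^ 2 - m ^ 2.

(* e^{i x} *)
Definition cis (x : R) : C := (cos x, sin x).

Definition alpha_plus (m lam theta : R) : C :=
  ((RtoC 1 - cis theta) / RtoC (m + lam))%C.
Definition alpha_minus (m lam theta : R) : C :=
  ((RtoC 1 - cis (- theta)) / RtoC (m + lam))%C.
Definition talpha_plus (m lam theta : R) : C :=
  ((RtoC 1 - cis (- theta)) / RtoC (lam - m))%C.
Definition talpha_minus (m lam theta : R) : C :=
  ((RtoC 1 - cis theta) / RtoC (lam - m))%C.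

Definition asymptotic_pinfty (w f : spinor_seq) : Prop :=
  is_lim_seq
    (fun k : nat => vnorm (vsub (w (Z.of_nat k)) (f (Z.of_nat k)))) 0.
Definition asymptotic_minfty (w f : spinor_seq) : Prop :=
  is_lim_seq
    (fun k : nat => vnorm (vsub (w (- Z.of_nat k)%Z) (f (- Z.of_nat k)%Z))) 0.

Definition jost_plus (m : R) (q : potential) (lam theta : R)
    (w : spinor_seq) : Prop :=
  solution m q (RtoC lam) w /\
  asymptotic_pinfty w (fun n =>
    vscal (cis (- (theta * IZR n))) (RtoC 1, alpha_plus m lam theta)).

Definition jost_minus (m : R) (q : potential) (lam theta : R)
    (w : spinor_seq) : Prop :=
  solution m q (RtoC lam) w /\
  asymptotic_minfty w (fun n =>
    vscal (cis (theta * IZR n)) (RtoC 1, alpha_minus m lam theta)).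

Definition tjost_plus (m : R) (q : potential) (lam theta : R)
    (w : spinor_seq) : Prop :=
  solution m q (RtoC lam) w /\
  asymptotic_pinfty w (fun n =>
    vscal (cis (- (theta * IZR n))) (talpha_plus m lam theta, RtoC 1)).

Definition tjost_minus (m : R) (q : potential) (lam theta : R)
    (w : spinor_seq) : Prop :=
  solution m q (RtoC lam) w /\
  asymptotic_minfty w (fun n =>
    vscal (cis (theta * IZR n)) (talpha_minus m lam theta, RtoC 1)).

Definition lin_comb (a b : C) (w1 w2 : spinor_seq) : spinor_seq :=
  fun n => vadd (vscal a (w1 n)) (vscal b (w2 n)).

Definition fundamental_system (m : R) (q : potential) (lam : C)
    (w1 w2 : spinor_seq) : Prop :=
  (forall w : spinor_seq,
     solution m q lam w <->
     exists a b : C, forall n : Z, w n = lin_comb a b w1 w2 n) /\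
  (forall a b : C,
     (forall n : Z, lin_comb a b w1 w2 n = vzero) ->
     a = RtoC 0 /\ b = RtoC 0).

Definition not_l2_near_infinities (w : spinor_seq) : Prop :=
  ~ l2_near_pinfty w /\ ~ l2_near_minfty w.

(* Main.v *)
Require Import Defs.
From Stdlib Require Import Reals ZArith Lra Lia Classical FunctionalExtensionality.
From Coquelicot Require Import Coquelicot.
Open Scope R_scope.

(* In the pairing W_n(w,w') = u_n v'_{n+1} - v_{n+1} u'_n the Wronskian of two solutions is
   constant, and that of a solution with a free solution g changes by
   -(q11 u g1 + q21 u g2 + q12 v g1 + q22 v g2)_{n+1}.  As q is summable, a discrete
   Gronwall bound makes the Wronskians of every solution with the plane wave G and with its
   conjugate converge at +oo, and Cramer's rule turns these limits into the asymptotics of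
   the solution.  The reflection n -> -n, exchanging u with v and m with -m, carries this over
   to -oo.  At +oo a Jost solution w and its conjugate have a nonzero Wronskian, hence a
   solution that tends to 0 has vanishing Wronskian with both and is zero: no eigenvalues,
   uniqueness, and no square summability at either end. *)

(** * Summable perturbations of real and complex sequences *)

(** Inside a band a plane wave and its conjugate are independent: their Wronskian is [i * flux],
    with [flux] proportional to [sin theta]. The estimate can therefore close on Wronskians alone:
    they bound the solution, and the solution bounds their increments. It closes only implicitly,
    since u_{n+1} is controlled by the Wronskians at n+1 but v_{n+1} by those at n; hence the
    Gronwall step has both ends on its right side. No Volterra equation is solved for the Jost
    solutions. Two arbitrary independent solutions are recombined so that the limits of their
    Wronskians become the Wronskians of the plane wave itself. Independence of the Jost solutions
    from opposite ends is a matter of signs: their currents have denominators lam + m and lam - m,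
    whose product 2 - 2 cos theta is positive. The normalizations (1, alpha) and (talpha, 1) are
    proportional, so the argument runs with an unspecified amplitude vector. *)

Lemma sum_n_le_lim (r : nat -> R) (l : R) (n : nat) :
  (forall k, 0 <= r k) -> is_series r l -> sum_n r n <= l.
Proof.
  intros r0 rl.
  apply (is_lim_seq_incr_compare (sum_n r) l); [exact rl |].
  intros k; rewrite sum_Sn; unfold plus; simpl; specialize (r0 (S k)); lra.
Qed.

Lemma bounded_of_eventually_bounded (s : nat -> R) (N : nat) (M : R) :
  (forall n, (N <= n)%nat -> s n <= M) -> exists M', forall n, s n <= M'.
Proof.
  revert M; induction N as [|N IH]; intros M hM.
  - exists M; intros n; apply hM; lia.
  - apply (IH (Rmax M (s N))); intros n hn.
    destruct (Nat.eq_dec n N) as [->|ne]; [apply Rmax_r |].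
    apply Rle_trans with M; [apply hM; lia | apply Rmax_l].
Qed.

(** Summability makes r n at most 1/2 from some N on. There the step can be solved for [s (S n)],
    with factor (1 + r)/(1 - r) <= 1 + 4 r <= exp (4 r), and the product of these factors is at most
    exp of four times the total sum. *)
Lemma gronwall_bounded (s r : nat -> R) :
  (forall n, 0 <= s n) -> (forall n, 0 <= r n) -> ex_series r ->
  (forall n, s (S n) <= s n + r n * (s n + s (S n))) ->
  exists M, forall n, s n <= M.
Proof.
  intros s0 r0 [l rl] step.
  assert (small : exists N, forall n, (N <= n)%nat -> r n <= / 2).
  { assert (r_lim : is_lim_seq r 0) by (apply ex_series_lim_0; now exists l).
    apply is_lim_seq_spec in r_lim.
    destruct (r_lim (mkposreal (/ 2) ltac:(lra))) as [N hN]; exists N; intros n hn.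
    specialize (hN n hn); simpl in hN.
    apply Rabs_def2 in hN; lra. }
  destruct small as [N hN].
  (* [sum_n] includes its last index. Subtracting [r (N + k)] leaves the sum over indices below N +
     k, so that one step adds exactly 4 r n to the exponent. *)
  assert (growth : forall k,
    s (N + k)%nat <= s N * exp (4 * (sum_n r (N + k)%nat - r (N + k)%nat))).
  { induction k as [|k IH].
    - rewrite Nat.add_0_r.
      assert (0 <= sum_n r N - r N).
      { destruct N as [|N']; [rewrite sum_O; lra |].
        rewrite sum_Sn; unfold plus; simpl.
        assert (0 <= sum_n r N'); [| lra].
        clear -r0; induction N' as [|N' IH]; [rewrite sum_O; apply r0 |].
        rewrite sum_Sn; unfold plus; simpl; specialize (r0 (S N')); lra. }
      assert (1 <= exp (4 * (sum_n r N - r N))).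
      { pose proof (exp_ineq1_le (4 * (sum_n r N - r N))); lra. }
      specialize (s0 N); nra.
    - rewrite Nat.add_succ_r, sum_Sn; unfold plus; simpl.
      set (n := (N + k)%nat) in *.
      replace (4 * (sum_n r n + r (S n) - r (S n)))
        with (4 * (sum_n r n - r n) + 4 * r n) by ring.
      rewrite exp_plus.
      assert (hr : r n <= / 2) by (apply hN; unfold n; lia).
      pose proof (step n) as hs; pose proof (s0 n); pose proof (r0 n).
      assert (h1 : s (S n) <= (1 + 4 * r n) * s n).
      { apply Rmult_le_reg_l with (1 - r n); [lra |].
        apply Rle_trans with ((1 + r n) * s n); [lra |].
        (* Half of the gap: (1 - r)(1 + 4 r) - (1 + r) = 2 r (1 - 2 r). *)
        assert (0 <= (r n * (1 - 2 * r n)) * s n)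
          by (apply Rmult_le_pos; nra). nra. }
      pose proof (exp_ineq1_le (4 * r n)) as h2.
      apply Rle_trans with (exp (4 * r n) * s n); [nra |].
      rewrite <- Rmult_assoc, (Rmult_comm _ (exp (4 * r n))).
      apply Rmult_le_compat_l; [left; apply exp_pos | exact IH]. }
  apply (bounded_of_eventually_bounded s N (s N * exp (4 * l))); intros n hn.
  replace n with (N + (n - N))%nat by lia.
  eapply Rle_trans; [apply growth |].
  apply Rmult_le_compat_l; [apply s0 |].
  assert (hle : 4 * (sum_n r (N + (n - N))%nat - r (N + (n - N))%nat) <= 4 * l).
  { pose proof (sum_n_le_lim r l (N + (n - N)) r0 rl).
    specialize (r0 (N + (n - N))%nat); lra. }
  destruct hle as [hlt|heq]; [left; now apply exp_increasing | rewrite heq; lra].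
Qed.

Lemma cv_of_summable_increments (x b : nat -> R) :
  (forall n, Rabs (x (S n) - x n) <= b n) -> ex_series b ->
  exists l : R, is_lim_seq x l.
Proof.
  intros hx hb.
  destruct (ex_series_le (fun n => x (S n) - x n) b hx hb) as [l hl].
  exists (l + x O); apply is_lim_seq_incr_1.
  apply is_lim_seq_ext with (fun n => sum_n (fun k => x (S k) - x k) n + x O).
  - induction n as [|n IH]; [rewrite sum_O; ring |].
    rewrite sum_Sn; unfold plus; simpl; simpl in IH; lra.
  - apply is_lim_seq_plus'; [exact hl | apply is_lim_seq_const].
Qed.

(** * Null and bounded complex sequences *)

Definition null (a : nat -> C) : Prop := is_lim_seq (fun n => Cmod (a n)) 0.
Definition C_bounded (a : nat -> C) : Prop := exists M, forall n, Cmod (a n) <= M.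

Lemma null_le (a : nat -> C) (b : nat -> R) :
  (forall n, Cmod (a n) <= b n) -> is_lim_seq b 0 -> null a.
Proof.
  intros hab hb; unfold null.
  apply is_lim_seq_le_le with (fun _ => 0) b; [| apply is_lim_seq_const | exact hb].
  intros n; split; [apply Cmod_ge_0 | apply hab].
Qed.

Lemma null_ext (a b : nat -> C) : (forall n, a n = b n) -> null a -> null b.
Proof.
  intros hab; apply is_lim_seq_ext; intros n; now rewrite hab.
Qed.

Lemma null_plus (a b : nat -> C) :
  null a -> null b -> null (fun n => (a n + b n)%C).
Proof.
  intros ha hb.
  apply null_le with (fun n => Cmod (a n) + Cmod (b n)).
  - intros n; apply Cmod_triangle.
  - replace (Finite 0) with (Finite (0 + 0)) by (f_equal; ring).
    now apply is_lim_seq_plus'.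
Qed.

Lemma null_mult_bounded (a b : nat -> C) :
  null a -> C_bounded b -> null (fun n => (a n * b n)%C).
Proof.
  intros ha [M hM].
  apply null_le with (fun n => Cmod (a n) * M).
  - intros n; rewrite Cmod_mult.
    apply Rmult_le_compat_l; [apply Cmod_ge_0 | apply hM].
  - replace (Finite 0) with (Finite (0 * M)) by (f_equal; ring).
    apply is_lim_seq_mult'; [exact ha | apply is_lim_seq_const].
Qed.

Lemma null_opp (a : nat -> C) : null a -> null (fun n => (- a n)%C).
Proof.
  apply is_lim_seq_ext; intros n; now rewrite Cmod_opp.
Qed.

Lemma null_minus (a b : nat -> C) :
  null a -> null b -> null (fun n => (a n - b n)%C).
Proof.
  intros ha hb; apply null_plus; [exact ha | now apply null_opp].
Qed.

Lemma null_conj (a : nat -> C) : null a -> null (fun n => Cconj (a n)).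
Proof.
  apply is_lim_seq_ext; intros n; now rewrite Cmod_conj.
Qed.

Lemma null_incr_1 (a : nat -> C) : null a -> null (fun n => a (S n)).
Proof. intros ha; apply (is_lim_seq_incr_1 (fun n => Cmod (a n))); exact ha. Qed.

Lemma null_const (c : C) : null (fun _ => c) -> c = RtoC 0.
Proof.
  intros hc; apply Cmod_eq_0.
  apply is_lim_seq_unique in hc; rewrite Lim_seq_const in hc.
  now injection hc.
Qed.

Lemma bounded_const (c : C) : C_bounded (fun _ => c).
Proof. exists (Cmod c); intros n; apply Rle_refl. Qed.

Lemma null_cancel (c : C) (a : nat -> C) :
  c <> RtoC 0 -> null (fun k => (c * a k)%C) -> null a.
Proof.
  intros c0 hc.
  refine (null_ext _ _ _ (null_mult_bounded _ _ hc (bounded_const (/ c)%C))).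
  intros k; simpl; field; exact c0.
Qed.

Lemma bounded_of_null_minus (a b : nat -> C) :
  null (fun n => (a n - b n)%C) -> C_bounded b -> C_bounded a.
Proof.
  intros hab [M hM].
  apply is_lim_seq_spec in hab.
  destruct (hab (mkposreal 1 Rlt_0_1)) as [N hN]; simpl in hN.
  apply (bounded_of_eventually_bounded _ N (1 + M)); intros n hn.
  specialize (hN n hn); rewrite Rminus_0_r, Rabs_pos_eq in hN by apply Cmod_ge_0.
  replace (a n) with ((a n - b n) + b n)%C by ring.
  eapply Rle_trans; [apply Cmod_triangle |]; specialize (hM n); lra.
Qed.

Lemma Cmod_le_Re_Im (z : C) : Cmod z <= Rabs (Re z) + Rabs (Im z).
Proof.
  replace z with (RtoC (Re z) + Ci * RtoC (Im z))%C
    by (destruct z; unfold Re, Im, Ci, RtoC, Cplus, Cmult; simpl; f_equal; ring).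
  eapply Rle_trans; [apply Cmod_triangle |].
  rewrite Cmod_mult, Cmod_Ci, !Cmod_R, Rmult_1_l.
  destruct z; unfold Re, Im, Ci, RtoC, Cplus, Cmult; simpl.
  right; f_equal; f_equal; ring.
Qed.

Lemma Cmod_Re_Im_le (z : C) : Rabs (Re z) <= Cmod z /\ Rabs (Im z) <= Cmod z.
Proof.
  pose proof (Rmax_Cmod z); split;
    (eapply Rle_trans; [| eassumption]); [apply Rmax_l | apply Rmax_r].
Qed.

Lemma complex_cv_of_summable_increments (x : nat -> C) (b : nat -> R) :
  (forall n, Cmod (x (S n) - x n) <= b n) -> ex_series b ->
  exists l : C, null (fun n => (x n - l)%C).
Proof.
  intros hx hb.
  destruct (cv_of_summable_increments (fun n => Re (x n)) b) as [lr hr]; [| exact hb |].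
  { intros n; eapply Rle_trans; [| apply hx]; apply (proj1 (Cmod_Re_Im_le (x (S n) - x n))). }
  destruct (cv_of_summable_increments (fun n => Im (x n)) b) as [li hi]; [| exact hb |].
  { intros n; eapply Rle_trans; [| apply hx]; apply (proj2 (Cmod_Re_Im_le (x (S n) - x n))). }
  assert (lim_abs : forall (y : nat -> R) (l : R),
            is_lim_seq y l -> is_lim_seq (fun n => Rabs (y n - l)) 0).
  { intros y l hy; apply (is_lim_seq_abs_0 (fun n => y n - l)).
    replace (Finite 0) with (Finite (l - l)) by (f_equal; ring).
    apply is_lim_seq_minus'; [exact hy | apply is_lim_seq_const]. }
  exists (lr, li).
  apply null_le with (fun n => Rabs (Re (x n) - lr) + Rabs (Im (x n) - li)).
  - intros n; apply (Cmod_le_Re_Im (x n - (lr, li))).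
  - replace (Finite 0) with (Finite (0 + 0)) by (f_equal; ring).
    apply is_lim_seq_plus'; now apply lim_abs.
Qed.

Lemma null_of_incr_1 (a : nat -> C) : null (fun k => a (S k)) -> null a.
Proof. apply (is_lim_seq_incr_1 (fun k => Cmod (a k))). Qed.

Lemma bounded_conj (a : nat -> C) : C_bounded a -> C_bounded (fun k => Cconj (a k)).
Proof. intros [M hM]; exists M; intros k; now rewrite Cmod_conj. Qed.

(** Going backwards from 0, each new value only has to be a preimage of the previous one under T,
    and S selects it. *)
Lemma Z_recursion {X : Type} (T S : Z -> X -> X) (x0 : X) :
  (forall n x, T n (S n x) = x) ->
  exists Y : Z -> X, Y 0%Z = x0 /\ forall n, Y (n + 1)%Z = T n (Y n).
Proof.
  intros TS.
  pose (fwd := fix fwd (k : nat) : X :=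
    match k with O => x0 | Datatypes.S j => T (Z.of_nat j) (fwd j) end).
  pose (bwd := fix bwd (k : nat) : X :=
    match k with O => x0 | Datatypes.S j => S (- Z.of_nat (Datatypes.S j))%Z (bwd j) end).
  exists (fun n => if (0 <=? n)%Z then fwd (Z.to_nat n) else bwd (Z.to_nat (- n))).
  split; [reflexivity |]; intros n.
  destruct (Z.leb_spec 0 n) as [hn|hn].
  - replace (0 <=? n + 1)%Z with true by (symmetry; apply Z.leb_le; lia).
    replace (Z.to_nat (n + 1)) with (Datatypes.S (Z.to_nat n)) by lia.
    simpl; now rewrite Z2Nat.id by lia.
  - replace (Z.to_nat (- n)) with (Datatypes.S (Z.to_nat (- n - 1))) by lia.
    cbn [bwd].
    replace (- Z.of_nat (Datatypes.S (Z.to_nat (- n - 1))))%Z with n by lia.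
    rewrite TS.
    destruct (Z.leb_spec 0 (n + 1)) as [hn'|hn'].
    (* The two halves meet at n = -1, where both give [x0] at 0. *)
    + replace n with (-1)%Z by lia; reflexivity.
    + f_equal; lia.
Qed.

(** * Decay of spinor sequences at +oo *)

Lemma vnorm_ge (x : spinor) : Cmod (fst x) <= vnorm x /\ Cmod (snd x) <= vnorm x.
Proof.
  pose proof (Cmod_ge_0 (fst x)); pose proof (Cmod_ge_0 (snd x)).
  unfold vnorm; split; apply Rsqr_incr_0_var; try apply sqrt_pos;
    rewrite Rsqr_sqrt; unfold Rsqr; nra.
Qed.

Lemma vnorm_le (x : spinor) : vnorm x <= Cmod (fst x) + Cmod (snd x).
Proof.
  pose proof (Cmod_ge_0 (fst x)); pose proof (Cmod_ge_0 (snd x)).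
  unfold vnorm; apply Rsqr_incr_0_var; [| lra].
  rewrite Rsqr_sqrt; unfold Rsqr; nra.
Qed.

Definition decays (w : spinor_seq) : Prop :=
  null (fun k => fst (w (Z.of_nat k))) /\ null (fun k => snd (w (Z.of_nat k))).

Lemma vnorm_lim_0_decays (w : spinor_seq) :
  is_lim_seq (fun k => vnorm (w (Z.of_nat k))) 0 <-> decays w.
Proof.
  split; [intros hw; split | intros [h1 h2]].
  - apply null_le with (2 := hw); intros k; apply vnorm_ge.
  - apply null_le with (2 := hw); intros k; apply vnorm_ge.
  - apply is_lim_seq_le_le with (fun _ => 0)
      (fun k => Cmod (fst (w (Z.of_nat k))) + Cmod (snd (w (Z.of_nat k)))).
    + intros k; split; [apply sqrt_pos | apply vnorm_le].
    + apply is_lim_seq_const.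
    + replace (Finite 0) with (Finite (0 + 0)) by (f_equal; ring).
      now apply is_lim_seq_plus'.
Qed.

Lemma decays_of_l2_near_pinfty (w : spinor_seq) : l2_near_pinfty w -> decays w.
Proof.
  intros hw; apply vnorm_lim_0_decays.
  apply ex_series_lim_0 in hw.
  apply is_lim_seq_ext with (fun k => sqrt (vnorm (w (Z.of_nat k)) ^ 2)).
  - intros k; apply sqrt_pow2, sqrt_pos.
  - rewrite <- sqrt_0.
    apply (is_lim_seq_continuous sqrt _ 0); [| exact hw].
    apply continuity_pt_sqrt; lra.
Qed.

(** Reduces uniqueness of a Jost solution to the triviality of decaying solutions. *)
Lemma decays_vsub (w1 w2 f : spinor_seq) :
  asymptotic_pinfty w1 f -> asymptotic_pinfty w2 f ->
  decays (fun n => vsub (w1 n) (w2 n)).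
Proof.
  intros h1 h2.
  apply (vnorm_lim_0_decays (fun n => vsub (w1 n) (f n))) in h1.
  apply (vnorm_lim_0_decays (fun n => vsub (w2 n) (f n))) in h2.
  destruct h1 as [h1u h1v], h2 as [h2u h2v]; split.
  - refine (null_ext _ _ _ (null_minus _ _ h1u h2u)); intros k; simpl; ring.
  - refine (null_ext _ _ _ (null_minus _ _ h1v h2v)); intros k; simpl; ring.
Qed.

(** * The difference equation and its Wronskian *)

(** The first component of the equation is solved at n for v_{n+1}, and the second at n+1 for u_n,
    so neither form divides by 1 + q21. Substituting both turns the increment of a Wronskian into a
    polynomial in the components at n+1. *)
Definition step_v (m : R) (q : potential) (lam : C) (w : spinor_seq) : Prop :=
  forall n : Z, snd (w (n + 1)%Z) =
    ((RtoC m + RtoC (q11 q n) - lam) * fst (w n) + (1 + RtoC (q12 q n)) * snd (w n))%C.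

Definition step_u (m : R) (q : potential) (lam : C) (w : spinor_seq) : Prop :=
  forall n : Z, fst (w n) =
    ((1 + RtoC (q21 q (n + 1))) * fst (w (n + 1)%Z)
     - (lam + RtoC m - RtoC (q22 q (n + 1))) * snd (w (n + 1)%Z))%C.

Lemma solution_steps (m : R) (q : potential) (lam : C) (w : spinor_seq) :
  solution m q lam w <-> step_v m q lam w /\ step_u m q lam w.
Proof.
  unfold solution, dirac, vadd, D0, Qop, vscal, d, dstar; simpl; split.
  - intros hw; split; intros n.
    + pose proof (f_equal fst (hw n)) as h1; cbn [fst snd] in h1; revert h1.
      generalize (fst (w n)) (snd (w n)) (snd (w (n + 1)%Z)); intros u v v' h1.
      transitivity ((RtoC m + RtoC (q11 q n) - lam) * u + (1 + RtoC (q12 q n)) * v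
        - ((RtoC m * u + (v - v') + (RtoC (q11 q n) * u + RtoC (q12 q n) * v)) - lam * u))%C;
        [ring | rewrite h1; ring].
    + pose proof (f_equal snd (hw (n + 1)%Z)) as h2; cbn [fst snd] in h2; revert h2.
      replace (n + 1 - 1)%Z with n by lia.
      generalize (fst (w n)) (snd (w (n + 1)%Z)) (fst (w (n + 1)%Z)); intros u v' u' h2.
      transitivity ((1 + RtoC (q21 q (n + 1))) * u'
        - (lam + RtoC m - RtoC (q22 q (n + 1))) * v'
        - ((u' - u - RtoC m * v' +
            (RtoC (q21 q (n + 1)) * u' + RtoC (q22 q (n + 1)) * v')) - lam * v'))%C;
        [ring | rewrite h2; ring].
  - intros [hv hu] n; f_equal.
    + rewrite hv; ring.
    + specialize (hu (n - 1)%Z); replace (n - 1 + 1)%Z with n in hu by lia.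
      rewrite hu; ring.
Qed.

Lemma RtoC_neq_0 (x : R) : x <> 0 -> RtoC x <> RtoC 0.
Proof. intros hx h; apply hx; now injection h. Qed.

Lemma ex_solution (m : R) (q : potential) (lam : C) (y0 : spinor) :
  (forall n, q12 q n = q21 q n) -> (forall n, q21 q n <> -1) ->
  exists w, solution m q lam w /\ fst (w 0%Z) = fst y0 /\ snd (w 1%Z) = snd y0.
Proof.
  intros hsym hne.
  (* [T n] carries (u_n, v_{n+1}) to (u_{n+1}, v_{n+2}): [step_u] is solved for u_{n+1}, which needs
     1 + q21 to be nonzero, and u_{n+1} is then fed into [step_v] at n+1. By symmetry of the
     potential the coefficient of v_{n+1} there is 1 + q21 too, so the inverse [S] divides by the
     same number. *)
  pose (T := fun (n : Z) (y : spinor) =>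
    let u := ((fst y + (lam + RtoC m - RtoC (q22 q (n + 1))) * snd y)
              / (1 + RtoC (q21 q (n + 1))))%C in
    (u, ((RtoC m + RtoC (q11 q (n + 1)) - lam) * u
         + (1 + RtoC (q21 q (n + 1))) * snd y)%C)).
  pose (S := fun (n : Z) (y : spinor) =>
    let v := ((snd y - (RtoC m + RtoC (q11 q (n + 1)) - lam) * fst y)
              / (1 + RtoC (q21 q (n + 1))))%C in
    (((1 + RtoC (q21 q (n + 1))) * fst y
      - (lam + RtoC m - RtoC (q22 q (n + 1))) * v)%C, v)).
  assert (hne' : forall n, (1 + RtoC (q21 q n))%C <> RtoC 0).
  { intros n; rewrite <- RtoC_plus; apply RtoC_neq_0; specialize (hne n); lra. }
  destruct (Z_recursion T S y0) as [Y [Y0 YS]].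
  { intros n [u v]; unfold T, S; simpl; f_equal; field; apply hne'. }
  (* The state [Y n] is (u_n, v_{n+1}), so v_n is stored in [Y (n - 1)]. *)
  exists (fun n => (fst (Y n), snd (Y (n - 1)%Z))); simpl.
  split; [| now rewrite Y0].
  apply solution_steps; split; intros n; simpl.
  - replace (n + 1 - 1)%Z with (n - 1 + 1)%Z by lia.
    rewrite hsym.
    pose proof (YS (n - 1)%Z) as h; replace (n - 1 + 1)%Z with n in * by lia.
    rewrite h at 1; rewrite h; unfold T; simpl; replace (n - 1 + 1)%Z with n by lia.
    reflexivity.
  - rewrite YS; replace (n + 1 - 1)%Z with n by lia; unfold T; simpl.
    field; apply hne'.
Qed.

Lemma solution_lin_comb (m : R) (q : potential) (lam a b : C) (w1 w2 : spinor_seq) :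
  solution m q lam w1 -> solution m q lam w2 -> solution m q lam (lin_comb a b w1 w2).
Proof.
  rewrite !solution_steps; intros [v1 u1] [v2 u2]; split; intros n; simpl.
  - rewrite v1, v2; ring.
  - rewrite u1, u2; ring.
Qed.

Lemma solution_vsub (m : R) (q : potential) (lam : C) (w1 w2 : spinor_seq) :
  solution m q lam w1 -> solution m q lam w2 ->
  solution m q lam (fun n => vsub (w1 n) (w2 n)).
Proof.
  rewrite !solution_steps; intros [v1 u1] [v2 u2]; split; intros n; simpl.
  - rewrite v1, v2; ring.
  - rewrite u1, u2; ring.
Qed.

Definition conjs (w : spinor_seq) : spinor_seq :=
  fun n => (Cconj (fst (w n)), Cconj (snd (w n))).

Lemma Cconj_RtoC (x : R) : Cconj (RtoC x) = RtoC x.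
Proof. unfold Cconj, RtoC; simpl; now rewrite Ropp_0. Qed.

Lemma solution_conjs (m : R) (q : potential) (lam : R) (w : spinor_seq) :
  solution m q (RtoC lam) w -> solution m q (RtoC lam) (conjs w).
Proof.
  rewrite !solution_steps; intros [hv hu]; split; intros n; simpl.
  - rewrite hv, !Cplus_conj, !Cmult_conj, !Cminus_conj, !Cplus_conj, !Cconj_RtoC; ring.
  - rewrite (hu n), !Cminus_conj, !Cmult_conj, !Cminus_conj, !Cplus_conj, !Cconj_RtoC; ring.
Qed.

(* The unknowns are paired as (u_n, v_{n+1}): this is the state that the
   difference equation propagates with a unimodular transfer matrix. *)
Definition wronskian (w w' : spinor_seq) (n : Z) : C :=
  (fst (w n) * snd (w' (n + 1)%Z) - snd (w (n + 1)%Z) * fst (w' n))%C.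

(** With the same mass and spectral parameter on both sides, only the potentials fail to cancel. Two
    potentials are allowed because two cases are used: q' = q symmetric, where the right side
    vanishes, and q' free, where it is of the size of q. *)
Lemma wronskian_increment (m : R) (q q' : potential) (lam : C) (w w' : spinor_seq) (n : Z) :
  solution m q lam w -> solution m q' lam w' ->
  (wronskian w w' (n + 1) - wronskian w w' n =
   (RtoC (q11 q' (n + 1)) - RtoC (q11 q (n + 1)))
     * fst (w (n + 1)%Z) * fst (w' (n + 1)%Z)
   + (RtoC (q12 q' (n + 1)) - RtoC (q21 q (n + 1)))
     * fst (w (n + 1)%Z) * snd (w' (n + 1)%Z)
   + (RtoC (q21 q' (n + 1)) - RtoC (q12 q (n + 1)))
     * snd (w (n + 1)%Z) * fst (w' (n + 1)%Z)
   + (RtoC (q22 q' (n + 1)) - RtoC (q22 q (n + 1)))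
     * snd (w (n + 1)%Z) * snd (w' (n + 1)%Z))%C.
Proof.
  rewrite !solution_steps; intros [v u] [v' u']; unfold wronskian.
  rewrite (v (n + 1)%Z), (v' (n + 1)%Z), (u n), (u' n); ring.
Qed.

Lemma constant_on_Z {X : Type} (f : Z -> X) :
  (forall n, f (n + 1)%Z = f n) -> forall n n', f n = f n'.
Proof.
  intros hf.
  assert (h : forall n, f n = f 0%Z).
  { apply Z.bi_induction; [now intros x y -> | reflexivity |].
    intros n; rewrite <- Z.add_1_r, hf; tauto. }
  intros n n'; now rewrite h, (h n').
Qed.

Lemma wronskian_constant (m : R) (q : potential) (lam : C) (w w' : spinor_seq) (n n' : Z) :
  (forall n, q12 q n = q21 q n) ->
  solution m q lam w -> solution m q lam w' -> wronskian w w' n = wronskian w w' n'.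
Proof.
  intros hsym hw hw'; apply constant_on_Z; clear n n'; intros n.
  transitivity (wronskian w w' n + (wronskian w w' (n + 1) - wronskian w w' n))%C; [ring |].
  rewrite (wronskian_increment m q q lam w w' n hw hw'), hsym; ring.
Qed.

Lemma wronskian_cramer (w g h : spinor_seq) (n : Z) :
  (wronskian g h n * fst (w n) =
     wronskian w h n * fst (g n) - wronskian w g n * fst (h n))%C /\
  (wronskian g h n * snd (w (n + 1)%Z) =
     wronskian w h n * snd (g (n + 1)%Z) - wronskian w g n * snd (h (n + 1)%Z))%C.
Proof. unfold wronskian; split; ring. Qed.

(** The Wronskian is the determinant of two states (u_n, v_{n+1}) in the plane, and any four vectors
    of a plane satisfy this quadratic relation. *)
Lemma wronskian_pluecker (a b c d : spinor_seq) (n : Z) :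
  (wronskian a b n * wronskian c d n =
   wronskian a c n * wronskian b d n - wronskian a d n * wronskian b c n)%C.
Proof. unfold wronskian; ring. Qed.

Lemma wronskian_lin_comb (a b : C) (w1 w2 g : spinor_seq) (n : Z) :
  wronskian (lin_comb a b w1 w2) g n =
  (a * wronskian w1 g n + b * wronskian w2 g n)%C.
Proof. unfold wronskian, lin_comb; simpl; ring. Qed.

Lemma wronskian_antisym (w w' : spinor_seq) (n : Z) :
  wronskian w' w n = (- wronskian w w' n)%C.
Proof. unfold wronskian; ring. Qed.

Lemma wronskian_self (w : spinor_seq) (n : Z) : wronskian w w n = RtoC 0.
Proof. unfold wronskian; ring. Qed.

Lemma wronskian_conjs (w w' : spinor_seq) (n : Z) :
  wronskian (conjs w) (conjs w') n = Cconj (wronskian w w' n).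
Proof.
  unfold wronskian, conjs; simpl; now rewrite Cminus_conj, !Cmult_conj.
Qed.

(** * Comparison with free solutions *)

Definition free_potential : potential :=
  mkPotential (fun _ => 0) (fun _ => 0) (fun _ => 0) (fun _ => 0).

(** Only the right half-line enters; summability on the left half-line is this same condition on the
    reflected potential. *)
Definition l1_near_pinfty (q : potential) : Prop :=
  ex_series (fun k => Rabs (q11 q (Z.of_nat k))) /\
  ex_series (fun k => Rabs (q12 q (Z.of_nat k))) /\
  ex_series (fun k => Rabs (q21 q (Z.of_nat k))) /\
  ex_series (fun k => Rabs (q22 q (Z.of_nat k))).

Definition size (q : potential) (n : Z) : R :=
  Rabs (q11 q n) + Rabs (q12 q n) + Rabs (q21 q n) + Rabs (q22 q n).

Lemma size_ge_0 (q : potential) (n : Z) : 0 <= size q n.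
Proof.
  unfold size; pose proof (Rabs_pos (q11 q n)); pose proof (Rabs_pos (q12 q n));
    pose proof (Rabs_pos (q21 q n)); pose proof (Rabs_pos (q22 q n)); lra.
Qed.

Lemma ex_series_size (q : potential) :
  l1_near_pinfty q -> ex_series (fun k => size q (Z.of_nat k + 1)).
Proof.
  intros [h11 [h12 [h21 h22]]].
  apply ex_series_ext with (fun k => size q (Z.of_nat (S k))).
  { intros k; f_equal; lia. }
  apply (ex_series_incr_1 (fun k => size q (Z.of_nat k))); unfold size.
  repeat (apply (@ex_series_plus R_AbsRing R_NormedModule)); assumption.
Qed.

Lemma free_wronskian_increment_le (m : R) (q : potential) (lam : C) (w g : spinor_seq)
    (P : R) (n : Z) :
  (forall n, Cmod (fst (g n)) <= P /\ Cmod (snd (g n)) <= P) ->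
  solution m q lam w -> solution m free_potential lam g ->
  Cmod (wronskian w g (n + 1) - wronskian w g n) <=
  size q (n + 1) * P * (Cmod (fst (w (n + 1)%Z)) + Cmod (snd (w (n + 1)%Z))).
Proof.
  intros hP hw hg.
  rewrite (wronskian_increment m q free_potential lam w g n hw hg).
  destruct (hP (n + 1)%Z) as [P1 P2].
  assert (term : forall (x : R) (u z : C), Cmod z <= P ->
    Cmod ((RtoC 0 - RtoC x) * u * z) <= Rabs x * P * Cmod u).
  { intros x u z hz.
    rewrite !Cmod_mult, <- RtoC_minus, Cmod_R, Rminus_0_l, Rabs_Ropp.
    pose proof (Rmult_le_compat_l (Rabs x * Cmod u) _ _
      (Rmult_le_pos _ _ (Rabs_pos x) (Cmod_ge_0 u)) hz); lra. }
  unfold free_potential; cbn [q11 q12 q21 q22].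
  generalize (fst (w (n + 1)%Z)) (snd (w (n + 1)%Z)); intros u v.
  pose proof (term (q11 q (n + 1)) u _ P1) as t1.
  pose proof (term (q21 q (n + 1)) u _ P2) as t2.
  pose proof (term (q12 q (n + 1)) v _ P1) as t3.
  pose proof (term (q22 q (n + 1)) v _ P2) as t4.
  eapply Rle_trans; [apply Cmod_triangle |].
  eapply Rle_trans; [apply Rplus_le_compat_r, Cmod_triangle |].
  eapply Rle_trans; [apply Rplus_le_compat_r, Rplus_le_compat_r, Cmod_triangle |].
  unfold size.
  pose proof (Cmod_ge_0 u); pose proof (Cmod_ge_0 v).
  assert (0 <= P) by (eapply Rle_trans; [apply Cmod_ge_0 | exact P1]).
  pose proof (Rabs_pos (q11 q (n + 1))); pose proof (Rabs_pos (q12 q (n + 1))).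
  pose proof (Rabs_pos (q21 q (n + 1))); pose proof (Rabs_pos (q22 q (n + 1))).
  (* The expanded right side has eight nonnegative terms. Four of them bound the increment, and the
     other four are dropped. *)
  assert (forall a b c, 0 <= a -> 0 <= b -> 0 <= c -> 0 <= a * b * c)
    as pos by (intros; repeat apply Rmult_le_pos; assumption).
  pose proof (pos (Rabs (q11 q (n + 1))) P (Cmod v)).
  pose proof (pos (Rabs (q21 q (n + 1))) P (Cmod v)).
  pose proof (pos (Rabs (q12 q (n + 1))) P (Cmod u)).
  pose proof (pos (Rabs (q22 q (n + 1))) P (Cmod u)).
  nra.
Qed.

Lemma bounded_on_nat (f : spinor_seq) (P : R) (j : Z) :
  (forall n, Cmod (fst (f n)) <= P /\ Cmod (snd (f n)) <= P) ->
  C_bounded (fun k => fst (f (Z.of_nat k + j)%Z)) /\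
  C_bounded (fun k => snd (f (Z.of_nat k + j)%Z)).
Proof. intros fP; split; exists P; intros k; apply fP. Qed.

Section FreeBasis.

Variables (m : R) (q : potential) (lam : C) (g h : spinor_seq) (P : R) (K : C).
Hypothesis hq : l1_near_pinfty q.
Hypothesis gP : forall n, Cmod (fst (g n)) <= P /\ Cmod (snd (g n)) <= P.
Hypothesis hP : forall n, Cmod (fst (h n)) <= P /\ Cmod (snd (h n)) <= P.
Hypothesis gfree : solution m free_potential lam g.
Hypothesis hfree : solution m free_potential lam h.
Hypothesis ghK : forall n, wronskian g h n = K.
Hypothesis K0 : K <> RtoC 0.

(** Neither Wronskian can be estimated alone, as its increment involves w. Their joint modulus [s]
    controls w by Cramer's rule, so Gronwall applies to [s]; once [s] is bounded, the increments of
    both are summable. *)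
Lemma free_wronskians_cv (w : spinor_seq) :
  solution m q lam w ->
  exists a b, null (fun k => (wronskian w g (Z.of_nat k) - a)%C) /\
              null (fun k => (wronskian w h (Z.of_nat k) - b)%C).
Proof.
  intros hw.
  pose (s := fun n => Cmod (wronskian w g n) + Cmod (wronskian w h n)).
  assert (s0 : forall n, 0 <= s n).
  { intros n; unfold s; pose proof (Cmod_ge_0 (wronskian w g n));
      pose proof (Cmod_ge_0 (wronskian w h n)); lra. }
  assert (P0 : 0 <= P).
  { eapply Rle_trans; [apply Cmod_ge_0 | apply (proj1 (gP 0%Z))]. }
  assert (Kpos : 0 < Cmod K) by now apply Cmod_gt_0.
  (* The shift matters: [s n] bounds u_n and v_{n+1}, so the components at n+1 are bounded by
     [s (n + 1)] and [s n] respectively. *)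
  assert (w_le : forall n, Cmod (fst (w n)) <= P / Cmod K * s n /\
                           Cmod (snd (w (n + 1)%Z)) <= P / Cmod K * s n).
  { intros n.
    assert (comb : forall z x y, (K * z = wronskian w h n * x - wronskian w g n * y)%C ->
              Cmod x <= P -> Cmod y <= P -> Cmod z <= P / Cmod K * s n).
    { intros z x y e hx hy.
      apply Rmult_le_reg_l with (Cmod K); [exact Kpos |].
      rewrite <- Cmod_mult, e.
      replace (Cmod K * (P / Cmod K * s n)) with (P * s n) by (field; lra).
      unfold s, Cminus; eapply Rle_trans; [apply Cmod_triangle |].
      rewrite Cmod_opp, !Cmod_mult.
      pose proof (Cmod_ge_0 (wronskian w g n)); pose proof (Cmod_ge_0 (wronskian w h n)).
      nra. }
    destruct (wronskian_cramer w g h n) as [e1 e2]; rewrite ghK in e1, e2.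
    split; [apply (comb _ _ _ e1) | apply (comb _ _ _ e2)];
      first [apply gP | apply hP]. }
  (* The factor 2 accounts for the two Wronskians in [s]: each moves by at most r/2 times (s n + s
     (n+1)). *)
  pose (r := fun n => size q (n + 1) * (2 * (P * (P / Cmod K)))).
  assert (c0 : 0 <= P * (P / Cmod K)).
  { apply Rmult_le_pos; [exact P0 |].
    apply Rmult_le_pos; [exact P0 | left; now apply Rinv_0_lt_compat]. }
  assert (incr_le : forall f,
    (forall n, Cmod (fst (f n)) <= P /\ Cmod (snd (f n)) <= P) ->
    solution m free_potential lam f -> forall n,
    Cmod (wronskian w f (n + 1) - wronskian w f n) <= r n / 2 * (s n + s (n + 1)%Z)).
  { intros f fP ffree n.
    eapply Rle_trans; [apply (free_wronskian_increment_le m q lam w f P n); assumption |].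
    unfold r.
    replace (size q (n + 1) * (2 * (P * (P / Cmod K))) / 2 * (s n + s (n + 1)%Z))
      with (size q (n + 1) * P * (P / Cmod K * s (n + 1)%Z + P / Cmod K * s n)) by (field; lra).
    apply Rmult_le_compat_l; [apply Rmult_le_pos; [apply size_ge_0 | exact P0] |].
    apply Rplus_le_compat; apply w_le. }
  assert (r0 : forall n, 0 <= r n).
  { intros n; unfold r; apply Rmult_le_pos; [apply size_ge_0 | lra]. }
  assert (r_sum : ex_series (fun k => r (Z.of_nat k))).
  { unfold r; apply ex_series_scal_r, ex_series_size, hq. }
  assert (Zs : forall k, Z.of_nat (S k) = (Z.of_nat k + 1)%Z) by (intros; lia).
  destruct (gronwall_bounded (fun k => s (Z.of_nat k)) (fun k => r (Z.of_nat k)))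
    as [M hM]; [intros; apply s0 | intros; apply r0 | exact r_sum | |].
  { intros k; rewrite Zs.
    set (n := Z.of_nat k).
    pose proof (incr_le g gP gfree n) as ig; pose proof (incr_le h hP hfree n) as ih.
    assert (tri : forall x y : C, Cmod y <= Cmod x + Cmod (y - x)).
    { intros x y; replace y with (x + (y - x))%C at 1 by ring; apply Cmod_triangle. }
    pose proof (tri (wronskian w g n) (wronskian w g (n + 1))) as tg.
    pose proof (tri (wronskian w h n) (wronskian w h (n + 1))) as th.
    assert (s (n + 1)%Z = Cmod (wronskian w g (n + 1)) + Cmod (wronskian w h (n + 1)))
      by reflexivity.
    assert (s n = Cmod (wronskian w g n) + Cmod (wronskian w h n)) by reflexivity.
    lra. }
  assert (cv : forall f,
    (forall n, Cmod (fst (f n)) <= P /\ Cmod (snd (f n)) <= P) ->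
    solution m free_potential lam f ->
    exists a, null (fun k => (wronskian w f (Z.of_nat k) - a)%C)).
  { intros f fP ffree.
    apply complex_cv_of_summable_increments with (fun k => r (Z.of_nat k) * M).
    - intros k; rewrite Zs.
      eapply Rle_trans; [now apply incr_le |].
      pose proof (hM k) as b1; pose proof (hM (S k)) as b2; rewrite Zs in b2.
      pose proof (r0 (Z.of_nat k)); nra.
    - apply ex_series_scal_r, r_sum. }
  destruct (cv g gP gfree) as [a ha], (cv h hP hfree) as [b hb].
  now exists a, b.
Qed.

(* The limits of the Wronskians against [g] and [h] of two independent solutions
   form an invertible matrix, because the Pluecker identity passes to the limit. *)
Lemma ex_solution_asymptotic_free :
  (forall n, q12 q n = q21 q n) -> (forall n, q21 q n <> -1) ->
  exists w, solution m q lam w /\ decays (fun n => vsub (w n) (g n)).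
Proof.
  intros hsym hne.
  destruct (ex_solution m q lam (RtoC 1, RtoC 0) hsym hne) as [w1 [sol1 [u1 v1]]].
  destruct (ex_solution m q lam (RtoC 0, RtoC 1) hsym hne) as [w2 [sol2 [u2 v2]]].
  assert (w12 : forall n, wronskian w1 w2 n = RtoC 1).
  { intros n; rewrite (wronskian_constant m q lam w1 w2 n 0 hsym sol1 sol2).
    unfold wronskian; simpl (0 + 1)%Z; rewrite u1, v1, u2, v2; simpl fst; simpl snd; ring. }
  destruct (free_wronskians_cv w1 sol1) as [a1 [b1 [ha1 hb1]]].
  destruct (free_wronskians_cv w2 sol2) as [a2 [b2 [ha2 hb2]]].
  (* With W(w1,w2) = 1 the Pluecker relation says W(w1,g) W(w2,h) - W(w1,h) W(w2,g) = K at every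
     index. *)
  assert (det : (a1 * b2 - b1 * a2 = K)%C).
  { assert (a1 * b2 - b1 * a2 - K = RtoC 0)%C; [| transitivity
      (a1 * b2 - b1 * a2 - K + K)%C; [ring | rewrite H; ring]].
    apply null_const.
    pose proof (bounded_of_null_minus _ _ hb2 (bounded_const b2)) as bb2.
    pose proof (bounded_of_null_minus _ _ ha2 (bounded_const a2)) as ba2.
    pose proof (null_mult_bounded _ _ ha1 bb2) as t1.
    pose proof (null_mult_bounded _ _ hb2 (bounded_const a1)) as t2.
    pose proof (null_mult_bounded _ _ hb1 ba2) as t3.
    pose proof (null_mult_bounded _ _ ha2 (bounded_const b1)) as t4.
    refine (null_ext _ _ _ (null_minus _ _ (null_plus _ _ t3 t4) (null_plus _ _ t1 t2))).
    intros k; cbv beta.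
    rewrite <- (ghK (Z.of_nat k)).
    pose proof (wronskian_pluecker w1 w2 g h (Z.of_nat k)) as pl; rewrite w12 in pl.
    transitivity (a1 * b2 - b1 * a2 -
      (wronskian w1 g (Z.of_nat k) * wronskian w2 h (Z.of_nat k) -
       wronskian w1 h (Z.of_nat k) * wronskian w2 g (Z.of_nat k)))%C; [ring |].
    rewrite <- pl; ring. }
  (* These coefficients make the Wronskians with g and h tend to 0 and, by [det], to K, which are
     the Wronskians of g itself with g and h. *)
  exists (lin_comb (- a2) a1 w1 w2).
  split; [now apply solution_lin_comb |].
  set (w := lin_comb (- a2) a1 w1 w2).
  assert (hg : null (fun k => wronskian w g (Z.of_nat k))).
  { pose proof (null_mult_bounded _ _ ha1 (bounded_const (- a2)%C)) as t1.
    pose proof (null_mult_bounded _ _ ha2 (bounded_const a1)) as t2.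
    refine (null_ext _ _ _ (null_plus _ _ t1 t2)); intros k; cbv beta.
    unfold w; rewrite wronskian_lin_comb; ring. }
  assert (hh : null (fun k => (wronskian w h (Z.of_nat k) - K)%C)).
  { pose proof (null_mult_bounded _ _ hb1 (bounded_const (- a2)%C)) as t1.
    pose proof (null_mult_bounded _ _ hb2 (bounded_const a1)) as t2.
    refine (null_ext _ _ _ (null_plus _ _ t1 t2)); intros k; cbv beta.
    unfold w; rewrite wronskian_lin_comb, <- det; ring. }
  assert (err : forall (z x y : nat -> C), C_bounded x -> C_bounded y ->
    (forall k, (K * z k = wronskian w h (Z.of_nat k) * x k
                          - wronskian w g (Z.of_nat k) * y k)%C) ->
    null (fun k => (z k - x k)%C)).
  { intros z x y bx yb e; apply (null_cancel K); [exact K0 |].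
    refine (null_ext _ _ _ (null_minus _ _ (null_mult_bounded _ _ hh bx)
      (null_mult_bounded _ _ hg yb))); intros k; cbv beta.
    transitivity (K * z k - K * x k)%C; [rewrite e; ring | ring]. }
  destruct (bounded_on_nat g P 0 gP) as [bg1 _], (bounded_on_nat h P 0 hP) as [bh1 _].
  destruct (bounded_on_nat g P 1 gP) as [_ bg2], (bounded_on_nat h P 1 hP) as [_ bh2].
  split.
  - refine (null_ext _ _ _ (err (fun k => fst (w (Z.of_nat k))) _ _ bg1 bh1 _)).
    + intros k; cbv beta; now rewrite Z.add_0_r.
    + intros k; cbv beta; rewrite !Z.add_0_r, <- (ghK (Z.of_nat k)).
      apply (wronskian_cramer w g h (Z.of_nat k)).
  (* Cramer's rule at k yields the second component at k + 1, so its convergence is proved for the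
     shifted sequence. *)
  - apply null_of_incr_1.
    refine (null_ext _ _ _ (err (fun k => snd (w (Z.of_nat k + 1)%Z)) _ _ bg2 bh2 _)).
    + intros k; cbv beta.
      replace (Z.of_nat (S k)) with (Z.of_nat k + 1)%Z by lia; reflexivity.
    + intros k; cbv beta; rewrite <- (ghK (Z.of_nat k)).
      apply (wronskian_cramer w g h (Z.of_nat k)).
Qed.

End FreeBasis.

(** * Plane waves and Jost solutions *)

Lemma cis_plus (x y : R) : cis (x + y) = (cis x * cis y)%C.
Proof. unfold cis, Cmult; simpl; rewrite cos_plus, sin_plus; f_equal; ring. Qed.

Lemma cis_conj (x : R) : Cconj (cis x) = cis (- x).
Proof. unfold cis, Cconj; simpl; now rewrite cos_neg, sin_neg. Qed.

Lemma cis_mult_opp (x : R) : (cis x * cis (- x))%C = RtoC 1.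
Proof. rewrite <- cis_plus, Rplus_opp_r; unfold cis; now rewrite cos_0, sin_0. Qed.

Lemma Cmod_cis (x : R) : Cmod (cis x) = 1.
Proof.
  transitivity (sqrt 1); [unfold Cmod, cis; simpl; f_equal | apply sqrt_1].
  pose proof (sin2_cos2 x); unfold Rsqr in *; lra.
Qed.

Lemma quasimomentum_sin (m lam theta : R) : quasimomentum m lam theta -> sin theta <> 0.
Proof.
  intros [[[h1 h2]|[h1 h2]] _].
  - pose proof (sin_gt_0 (- theta) ltac:(lra) ltac:(lra)) as h; rewrite sin_neg in h; lra.
  - pose proof (sin_gt_0 theta h1 h2); lra.
Qed.

(** The product equals 2 - 2 cos theta, and sin theta <> 0 excludes cos theta = 1. Both factors are
    thus nonzero, as the denominators require, and of equal sign, which decides the signs of the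
    fluxes later. *)
Lemma quasimomentum_pos (m lam theta : R) :
  quasimomentum m lam theta -> 0 < (lam + m) * (lam - m).
Proof.
  intros hq; pose proof (quasimomentum_sin _ _ _ hq); destruct hq as [_ e].
  pose proof (sin2_cos2 theta) as sc; pose proof (COS_bound theta); unfold Rsqr in sc.
  assert (cos theta <> 1) by (intros c1; rewrite c1 in sc; nra).
  nra.
Qed.

(** This is the vanishing of the determinant of the two linear equations in [amplitude], hence their
    compatibility. *)
Lemma quasimomentum_cis (m lam theta : R) :
  quasimomentum m lam theta ->
  ((1 - cis theta) * (1 - cis (- theta)))%C = ((RtoC lam + RtoC m) * (RtoC lam - RtoC m))%C.
Proof.
  intros [_ e].
  transitivity (RtoC (2 - 2 * cos theta)).
  - transitivity (1 + cis theta * cis (- theta) - (cis theta + cis (- theta)))%C; [ring |].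
    rewrite cis_mult_opp; unfold cis, RtoC, Cminus, Cplus, Copp; simpl.
    rewrite cos_neg, sin_neg; f_equal; ring.
  - rewrite e, <- RtoC_plus, <- RtoC_minus, <- RtoC_mult; f_equal; ring.
Qed.

Lemma quasimomentum_neg_mass (m lam theta : R) :
  quasimomentum m lam theta -> quasimomentum (- m) lam theta.
Proof. intros [h e]; split; [exact h | lra]. Qed.

Lemma ex_quasimomentum (m lam : R) :
  0 < m -> Gamma m lam -> exists theta, quasimomentum m lam theta.
Proof.
  intros hm hG.
  assert (hl : m ^ 2 < lam ^ 2 < m ^ 2 + 4).
  { assert (s2 : sqrt (m ^ 2 + 4) * sqrt (m ^ 2 + 4) = m ^ 2 + 4)
      by (apply sqrt_sqrt; nra).
    pose proof (sqrt_pos (m ^ 2 + 4)).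
    destruct hG as [[h1 h2]|[h1 h2]]; split; nra. }
  pose (x := 1 - (lam ^ 2 - m ^ 2) / 2).
  assert (cx : cos (acos x) = x) by (apply cos_acos; unfold x; lra).
  pose proof (acos_bound x) as [b0 bP].
  exists (acos x); split; [right | rewrite cx; unfold x; field].
  split.
  - destruct b0 as [b0|b0]; [exact b0 |].
    rewrite <- b0, cos_0 in cx; unfold x in cx; lra.
  - destruct bP as [bP|bP]; [exact bP |].
    rewrite bP, cos_PI in cx; unfold x in cx; lra.
Qed.

(** The two equations place p in the kernel of the symbol of D0 - lam at the wave e^{-i theta n};
    [fst p <> 0] rules out the zero vector and keeps the flux nonzero. *)
Definition amplitude (m lam theta : R) (p : spinor) : Prop :=
  ((RtoC lam + RtoC m) * snd p)%C = ((1 - cis theta) * fst p)%C /\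
  ((RtoC lam - RtoC m) * fst p)%C = ((1 - cis (- theta)) * snd p)%C /\
  fst p <> RtoC 0.

Definition plane (theta : R) (p : spinor) : spinor_seq :=
  fun n => vscal (cis (- (theta * IZR n))) p.

Lemma plane_free (m lam theta : R) (p : spinor) :
  amplitude m lam theta p -> solution m free_potential (RtoC lam) (plane theta p).
Proof.
  intros [e1 [e2 _]].
  assert (cis_succ : forall n, cis (- (theta * IZR (n + 1))) =
            (cis (- (theta * IZR n)) * cis (- theta))%C).
  { intros n; rewrite <- cis_plus; f_equal; rewrite plus_IZR; ring. }
  apply solution_steps; split; intros n;
    unfold plane, vscal, free_potential; cbn [fst snd q11 q12 q21 q22];
    rewrite cis_succ; generalize (cis (- (theta * IZR n))); intros c.
  - transitivity (c * (snd p - (1 - cis (- theta)) * snd p))%C; [ring |].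
    rewrite <- e2; ring.
  - transitivity (c * cis (- theta) * (fst p - (1 - cis theta) * fst p))%C.
    + transitivity (c * (cis theta * cis (- theta)) * fst p)%C; [| ring].
      rewrite cis_mult_opp; ring.
    + rewrite <- e1; ring.
Qed.

(** The conserved current of a plane wave: its Wronskian with its conjugate is purely imaginary, and
    this is the imaginary part. *)
Definition flux (m lam theta : R) (p : spinor) : R :=
  2 * sin theta * Cmod (fst p) ^ 2 / (lam + m).

Lemma wronskian_plane (m lam theta : R) (p : spinor) (n : Z) :
  lam + m <> 0 -> amplitude m lam theta p ->
  wronskian (plane theta p) (conjs (plane theta p)) n = (0, flux m lam theta p) :> C.
Proof.
  intros hlm [e1 _].
  assert (hlm' : (RtoC lam + RtoC m)%C <> RtoC 0)
    by (rewrite <- RtoC_plus; now apply RtoC_neq_0).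
  assert (e1' : ((RtoC lam + RtoC m) * Cconj (snd p))%C
                = ((1 - cis (- theta)) * Cconj (fst p))%C).
  { apply (f_equal Cconj) in e1.
    rewrite !Cmult_conj, Cplus_conj, Cminus_conj, cis_conj, !Cconj_RtoC in e1; exact e1. }
  assert (e3 : (0, flux m lam theta p) =
    ((cis theta - cis (- theta)) * (fst p * Cconj (fst p)) / (RtoC lam + RtoC m))%C :> C).
  { rewrite <- Cmod2_conj, <- RtoC_plus; unfold Cdiv; rewrite <- RtoC_inv by exact hlm.
    unfold flux, cis, RtoC, Cminus, Cmult, Cplus, Copp; simpl.
    rewrite cos_neg, sin_neg; f_equal; field; exact hlm. }
  rewrite e3; unfold wronskian, plane, conjs, vscal; cbn [fst snd].
  rewrite !Cmult_conj, !cis_conj.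
  replace (- (theta * IZR (n + 1))) with (- (theta * IZR n) + - theta)
    by (rewrite plus_IZR; ring).
  rewrite Ropp_plus_distr, !cis_plus, !Ropp_involutive.
  pose proof (cis_mult_opp (theta * IZR n)) as c1.
  transitivity ((cis (theta * IZR n) * cis (- (theta * IZR n))) *
    (cis theta * fst p * ((RtoC lam + RtoC m) * Cconj (snd p))
     - cis (- theta) * Cconj (fst p) * ((RtoC lam + RtoC m) * snd p))
    / (RtoC lam + RtoC m))%C; [field; exact hlm' |].
  rewrite c1, e1, e1'.
  pose proof (cis_mult_opp theta) as c2.
  transitivity (((cis theta - cis (- theta)) * (fst p * Cconj (fst p))
     + (cis theta * cis (- theta) - cis theta * cis (- theta)) * (fst p * Cconj (fst p)))
    / (RtoC lam + RtoC m))%C; [| rewrite c2]; field; exact hlm'.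
Qed.

Lemma flux_neq_0 (m lam theta : R) (p : spinor) :
  quasimomentum m lam theta -> amplitude m lam theta p -> flux m lam theta p <> 0.
Proof.
  intros hq [_ [_ p0]] h.
  pose proof (quasimomentum_sin _ _ _ hq); pose proof (quasimomentum_pos _ _ _ hq).
  assert (lam + m <> 0) by (intros e; rewrite e in *; lra).
  apply Cmod_gt_0 in p0.
  assert (hz : 2 * sin theta * Cmod (fst p) ^ 2 = 0)
    by (apply Rmult_eq_reg_r with (/ (lam + m));
        [unfold flux, Rdiv in h; lra | now apply Rinv_neq_0_compat]).
  apply Rmult_integral in hz; destruct hz as [hz|hz]; [lra |].
  apply pow_nonzero in hz; [exact hz | lra].
Qed.

Lemma plane_bounded (theta : R) (p : spinor) :
  let P := Cmod (fst p) + Cmod (snd p) in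
  (forall n, Cmod (fst (plane theta p n)) <= P /\ Cmod (snd (plane theta p n)) <= P) /\
  (forall n, Cmod (fst (conjs (plane theta p) n)) <= P /\
             Cmod (snd (conjs (plane theta p) n)) <= P).
Proof.
  pose proof (Cmod_ge_0 (fst p)); pose proof (Cmod_ge_0 (snd p)).
  split; intros n; unfold conjs, plane, vscal; cbn [fst snd];
    rewrite ?Cmod_conj, !Cmod_mult, Cmod_cis; lra.
Qed.

(** With p = (1, [alpha_plus]) or ([talpha_plus], 1) this unfolds to [jost_plus] or [tjost_plus], so
    one argument serves both bands. *)
Definition jost_right (m : R) (q : potential) (lam theta : R) (p : spinor)
    (w : spinor_seq) : Prop :=
  solution m q (RtoC lam) w /\ asymptotic_pinfty w (plane theta p).

Lemma ex_jost_right (m : R) (q : potential) (lam theta : R) (p : spinor) :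
  (forall n, q12 q n = q21 q n) -> (forall n, q21 q n <> -1) -> l1_near_pinfty q ->
  quasimomentum m lam theta -> amplitude m lam theta p ->
  exists w, jost_right m q lam theta p w.
Proof.
  intros hsym hne hq hth hp.
  pose proof (quasimomentum_pos _ _ _ hth) as pos.
  assert (lam + m <> 0) by (intros e; rewrite e in *; lra).
  destruct (plane_bounded theta p) as [b1 b2].
  pose proof (plane_free m lam theta p hp) as free.
  destruct (ex_solution_asymptotic_free m q (RtoC lam) (plane theta p) (conjs (plane theta p))
    (Cmod (fst p) + Cmod (snd p)) (0, flux m lam theta p) hq b1 b2 free
    (solution_conjs _ _ _ _ free)) as [w [sol asy]]; try assumption.
  - intros n; now apply wronskian_plane.
  - intros h; injection h; now apply flux_neq_0.
  - exists w; split; [exact sol |].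
    exact (proj2 (vnorm_lim_0_decays (fun n => vsub (w n) (plane theta p n))) asy).
Qed.

Lemma decays_wronskian (w w' : spinor_seq) :
  decays w -> C_bounded (fun k => fst (w' (Z.of_nat k))) ->
  C_bounded (fun k => snd (w' (Z.of_nat (S k)))) ->
  null (fun k => wronskian w w' (Z.of_nat k)).
Proof.
  intros [hu hv] bu bv.
  refine (null_ext _ _ _ (null_minus _ _ (null_mult_bounded _ _ hu bv)
    (null_mult_bounded _ _ (null_incr_1 _ hv) bu))).
  intros k; cbv beta; unfold wronskian.
  now replace (Z.of_nat (S k)) with (Z.of_nat k + 1)%Z by lia.
Qed.

Lemma jost_right_bounded (m : R) (q : potential) (lam theta : R) (p : spinor) (w : spinor_seq) :
  jost_right m q lam theta p w ->
  C_bounded (fun k => fst (w (Z.of_nat k))) /\ C_bounded (fun k => snd (w (Z.of_nat (S k)))).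
Proof.
  intros [_ asy].
  apply (vnorm_lim_0_decays (fun n => vsub (w n) (plane theta p n))) in asy.
  destruct (plane_bounded theta p) as [b _]; destruct asy as [au av].
  split.
  - refine (bounded_of_null_minus _ _ au _).
    eexists; intros k; apply b.
  - refine (bounded_of_null_minus _ _ (null_incr_1 _ av) _).
    eexists; intros k; apply b.
Qed.

(** The Wronskian does not depend on n, so it may be evaluated in the limit at +oo, where w is
    replaced by its plane wave. *)
Lemma jost_right_flux (m : R) (q : potential) (lam theta : R) (p : spinor)
    (w : spinor_seq) (n : Z) :
  (forall n, q12 q n = q21 q n) ->
  quasimomentum m lam theta -> amplitude m lam theta p -> jost_right m q lam theta p w ->
  wronskian w (conjs w) n = (0, flux m lam theta p) :> C.
Proof.
  intros hsym hth hp hj.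
  pose proof (quasimomentum_pos _ _ _ hth) as pos.
  assert (hlm : lam + m <> 0) by (intros e; rewrite e in *; lra).
  destruct (jost_right_bounded _ _ _ _ _ _ hj) as [bu bv].
  destruct hj as [sol asy].
  apply (vnorm_lim_0_decays (fun n => vsub (w n) (plane theta p n))) in asy.
  destruct (plane_bounded theta p) as [b _].
  set (g := plane theta p) in *.
  set (r := fun n => vsub (w n) (g n)) in *.
  assert (dr : decays (conjs r)) by (destruct asy as [au av]; split; now apply null_conj).
  assert (bg : C_bounded (fun k => fst (g (Z.of_nat k)))
               /\ C_bounded (fun k => snd (g (Z.of_nat (S k)))))
    by (split; eexists; intros k; apply b).
  destruct bg as [bgu bgv].
  (* With w = g + r, bilinearity and antisymmetry give W(w, conj w) - W(g, conj g) = W(r, conj w) -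
     W(conj r, g); each term pairs a decaying sequence with a bounded one. *)
  pose proof (decays_wronskian r (conjs w) asy (bounded_conj _ bu) (bounded_conj _ bv)) as t1.
  pose proof (decays_wronskian (conjs r) g dr bgu bgv) as t2.
  assert (z : (wronskian w (conjs w) n - (0, flux m lam theta p))%C = RtoC 0).
  { apply null_const.
    refine (null_ext _ _ _ (null_minus _ _ t1 t2)); intros k; cbv beta.
    rewrite (wronskian_constant m q (RtoC lam) w (conjs w) n (Z.of_nat k) hsym sol
      (solution_conjs _ _ _ _ sol)).
    rewrite <- (wronskian_plane m lam theta p (Z.of_nat k) hlm hp); fold g.
    unfold r, wronskian, conjs, vsub; cbn [fst snd]; rewrite !Cminus_conj; ring. }
  transitivity (wronskian w (conjs w) n - (0, flux m lam theta p) + (0, flux m lam theta p))%C;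
    [ring | rewrite z; ring].
Qed.

Lemma spinor_zero_of_fst_snd (w : spinor_seq) :
  (forall n, fst (w n) = RtoC 0) -> (forall n, snd (w (n + 1)%Z) = RtoC 0) ->
  forall n, w n = vzero.
Proof.
  intros hu hv n; specialize (hu n); specialize (hv (n - 1)%Z).
  replace (n - 1 + 1)%Z with n in hv by lia.
  rewrite (surjective_pairing (w n)), hu, hv; reflexivity.
Qed.

Lemma decaying_solution_zero (m : R) (q : potential) (lam theta : R) (w : spinor_seq) :
  (forall n, q12 q n = q21 q n) -> (forall n, q21 q n <> -1) -> l1_near_pinfty q ->
  quasimomentum m lam theta -> (exists p, amplitude m lam theta p) ->
  solution m q (RtoC lam) w -> decays w -> forall n, w n = vzero.
Proof.
  intros hsym hne hq hth [p hp] sol dec.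
  destruct (ex_jost_right m q lam theta p hsym hne hq hth hp) as [j hj].
  destruct (jost_right_bounded _ _ _ _ _ _ hj) as [bu bv].
  pose proof (fun n => jost_right_flux _ _ _ _ _ _ n hsym hth hp hj) as hf.
  pose proof (flux_neq_0 m lam theta p hth hp) as f0.
  assert (K0 : (0, flux m lam theta p) <> RtoC 0) by (intros h; now injection h).
  destruct hj as [solj _].
  assert (w0 : forall n, wronskian w j n = RtoC 0 /\ wronskian w (conjs j) n = RtoC 0).
  { intros n; split; apply null_const.
    - refine (null_ext _ _ _ (decays_wronskian w j dec bu bv)); intros k.
      now apply (wronskian_constant m q (RtoC lam)).
    - refine (null_ext _ _ _ (decays_wronskian w (conjs j) dec
        (bounded_conj _ bu) (bounded_conj _ bv))); intros k.
      apply (wronskian_constant m q (RtoC lam)); auto using solution_conjs. }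
  assert (cancel : forall z x y : C, ((0, flux m lam theta p) * z = RtoC 0 * x - RtoC 0 * y)%C ->
            z = RtoC 0).
  { intros z x y e.
    transitivity ((0, flux m lam theta p) * z / (0, flux m lam theta p))%C;
      [field; exact K0 | rewrite e; field; exact K0]. }
  apply spinor_zero_of_fst_snd; intros n;
    destruct (wronskian_cramer w j (conjs j) n) as [c1 c2], (w0 n) as [z1 z2];
    rewrite hf, z1, z2 in c1, c2; eauto.
Qed.

(** * Reflection *)

(** Reversing n exchanges d with its adjoint, and swapping the components puts them back in place at
    the price of turning the diagonal (m, -m) into (-m, m). The results at +oo are therefore stated
    for real m of either sign. *)
Definition refl (w : spinor_seq) : spinor_seq :=
  fun n => (snd (w (- n)%Z), fst (w (- n)%Z)).

Definition refl_potential (q : potential) : potential :=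
  mkPotential (fun n => q22 q (- n)) (fun n => q21 q (- n))
              (fun n => q12 q (- n)) (fun n => q11 q (- n)).

Definition swap (p : spinor) : spinor := (snd p, fst p).

Lemma solution_refl (m : R) (q : potential) (lam : C) (w : spinor_seq) :
  solution m q lam w <-> solution (- m) (refl_potential q) lam (refl w).
Proof.
  rewrite !solution_steps; unfold step_u, step_v, refl, refl_potential;
    cbn [fst snd q11 q12 q21 q22]; rewrite !RtoC_opp.
  assert (shift : forall n, (- (- n - 1) = n + 1)%Z) by (intros; lia).
  split; intros [h1 h2]; split; intros n.
  - rewrite (h2 (- (n + 1))%Z); replace (- (n + 1) + 1)%Z with (- n)%Z by lia; ring.
  - pose proof (h1 (- (n + 1))%Z) as h; replace (- (n + 1) + 1)%Z with (- n)%Z in h by lia.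
    rewrite h; ring.
  - pose proof (h2 (- (n + 1))%Z) as h.
    replace (- (- (n + 1) + 1))%Z with n in h by lia.
    replace (- (- (n + 1)))%Z with (n + 1)%Z in h by lia.
    rewrite h; ring.
  - pose proof (h1 (- (n + 1))%Z) as h.
    replace (- (- (n + 1) + 1))%Z with n in h by lia.
    replace (- (- (n + 1)))%Z with (n + 1)%Z in h by lia.
    rewrite h; ring.
Qed.

(** The state (u_n, v_{n+1}) becomes the state (v_{n+1}, u_n) of the reflected sequence at -n-1; the
    swap reverses the sign of the determinant. *)
Lemma wronskian_refl (w w' : spinor_seq) (n : Z) :
  wronskian (refl w) (refl w') (- n - 1) = (- wronskian w w' n)%C.
Proof.
  unfold wronskian, refl; cbn [fst snd].
  replace (- (- n - 1))%Z with (n + 1)%Z by lia.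
  replace (- (- n - 1 + 1))%Z with n by lia; ring.
Qed.

Lemma vnorm_swap (a b : C) : vnorm (b, a) = vnorm (a, b).
Proof. unfold vnorm; simpl fst; simpl snd; f_equal; ring. Qed.

Definition jost_left (m : R) (q : potential) (lam theta : R) (p : spinor)
    (w : spinor_seq) : Prop :=
  solution m q (RtoC lam) w /\
  asymptotic_minfty w (fun n => vscal (cis (theta * IZR n)) p).

Lemma jost_left_refl (m : R) (q : potential) (lam theta : R) (p : spinor) (w : spinor_seq) :
  jost_left m q lam theta p w <->
  jost_right (- m) (refl_potential q) lam theta (swap p) (refl w).
Proof.
  unfold jost_left, jost_right; rewrite solution_refl.
  unfold asymptotic_minfty, asymptotic_pinfty.
  assert (e : forall k : nat,
    vnorm (vsub (w (- Z.of_nat k)%Z) (vscal (cis (theta * IZR (- Z.of_nat k))) p)) =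
    vnorm (vsub (refl w (Z.of_nat k)) (plane theta (swap p) (Z.of_nat k)))).
  { intros k; unfold vsub, vscal, refl, plane, vscal, swap; cbn [fst snd].
    rewrite vnorm_swap, opp_IZR; now replace (theta * - IZR (Z.of_nat k))
      with (- (theta * IZR (Z.of_nat k))) by ring. }
  split; intros [h1 h2]; split; try assumption.
  - exact (is_lim_seq_ext _ _ _ e h2).
  - exact (is_lim_seq_ext _ _ _ (fun k => eq_sym (e k)) h2).
Qed.

Lemma l2_near_minfty_refl (w : spinor_seq) : l2_near_minfty w -> l2_near_pinfty (refl w).
Proof.
  apply ex_series_ext; intros k; f_equal; unfold refl.
  rewrite vnorm_swap; now rewrite <- surjective_pairing.
Qed.

Lemma refl_eq_0 (w : spinor_seq) : (forall n, refl w n = vzero) -> forall n, w n = vzero.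
Proof.
  intros h n; specialize (h (- n)%Z); unfold refl in h; rewrite Z.opp_involutive in h.
  injection h as hv hu.
  now rewrite (surjective_pairing (w n)), hu, hv.
Qed.

Lemma vsub_eq_0 (x y : spinor) : vsub x y = vzero -> x = y.
Proof.
  destruct x as [a b], y as [c e]; unfold vsub, vzero; cbn [fst snd]; intros h.
  assert (h1 : (a - c)%C = RtoC 0) by exact (f_equal fst h).
  assert (h2 : (b - e)%C = RtoC 0) by exact (f_equal snd h).
  f_equal.
  - transitivity (a - c + c)%C; [ring | rewrite h1; ring].
  - transitivity (b - e + e)%C; [ring | rewrite h2; ring].
Qed.

Lemma refl_vsub (w w' : spinor_seq) :
  refl (fun n => vsub (w n) (w' n)) = (fun n => vsub (refl w n) (refl w' n)).
Proof. reflexivity. Qed.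

(** * Fundamental systems *)

Lemma fundamental_of_wronskian (m : R) (q : potential) (lam : C) (w1 w2 : spinor_seq) :
  (forall n, q12 q n = q21 q n) -> solution m q lam w1 -> solution m q lam w2 ->
  wronskian w1 w2 0 <> RtoC 0 -> fundamental_system m q lam w1 w2.
Proof.
  intros hsym sol1 sol2 K0.
  set (K := wronskian w1 w2 0) in *.
  assert (hK : forall n, wronskian w1 w2 n = K)
    by (intros n; now apply (wronskian_constant m q lam)).
  split.
  - intros w; split.
    + intros sol.
      (* The coefficients of Cramer's rule; they are the same at every n because the Wronskians are
         constant. *)
      exists (wronskian w w2 0 / K)%C, (- wronskian w w1 0 / K)%C.
      assert (u_comb : forall n, fst (w n) =
        (wronskian w w2 0 / K * fst (w1 n) + - wronskian w w1 0 / K * fst (w2 n))%C).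
      { intros n; destruct (wronskian_cramer w w1 w2 n) as [e _].
        rewrite hK, (wronskian_constant m q lam w w2 n 0),
          (wronskian_constant m q lam w w1 n 0) in e by assumption.
        transitivity (K * fst (w n) / K)%C; [field; exact K0 | rewrite e; field; exact K0]. }
      assert (v_comb : forall n, snd (w (n + 1)%Z) =
        (wronskian w w2 0 / K * snd (w1 (n + 1)%Z)
         + - wronskian w w1 0 / K * snd (w2 (n + 1)%Z))%C).
      { intros n; destruct (wronskian_cramer w w1 w2 n) as [_ e].
        rewrite hK, (wronskian_constant m q lam w w2 n 0),
          (wronskian_constant m q lam w w1 n 0) in e by assumption.
        transitivity (K * snd (w (n + 1)%Z) / K)%C;
          [field; exact K0 | rewrite e; field; exact K0]. }
      intros n; specialize (u_comb n); specialize (v_comb (n - 1)%Z).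
      replace (n - 1 + 1)%Z with n in v_comb by lia.
      rewrite (surjective_pairing (w n)), u_comb, v_comb; reflexivity.
    + intros [a [b e]].
      apply functional_extensionality in e; rewrite e; now apply solution_lin_comb.
  - intros a b z.
    apply functional_extensionality in z.
    assert (zero : forall g : spinor_seq, wronskian (fun _ => vzero) g 0 = RtoC 0)
      by (intros g; unfold wronskian, vzero; cbn [fst snd]; ring).
    pose proof (wronskian_lin_comb a b w1 w2 w1 0) as e1.
    pose proof (wronskian_lin_comb a b w1 w2 w2 0) as e2.
    replace (lin_comb a b w1 w2) with (fun _ : Z => vzero) in e1, e2
      by (symmetry; exact z).
    rewrite zero, wronskian_self, wronskian_antisym in e1; rewrite zero, wronskian_self in e2.
    fold K in e1, e2; split.
    + transitivity ((a * K + b * 0) / K)%C; [field; exact K0 | rewrite <- e2; field; exact K0].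
    + transitivity (- (a * 0 + b * - K) / K)%C;
        [field; exact K0 | rewrite <- e1; field; exact K0].
Qed.

Lemma wronskian_neq_0_nonzero (w w' : spinor_seq) (n : Z) :
  wronskian w w' n <> RtoC 0 -> exists k, w k <> vzero.
Proof.
  intros h.
  destruct (classic (exists k, w k <> vzero)) as [e|e]; [exact e |].
  exfalso; apply h; unfold wronskian.
  assert (z : forall k, w k = vzero)
    by (intros k; apply NNPP; intros c; apply e; now exists k).
  rewrite !z; unfold vzero; cbn [fst snd]; ring.
Qed.

(** * The pair of Jost solutions from the two ends *)

Section JostSystem.

Variables (m : R) (q : potential).
Hypothesis hsym : forall n, q12 q n = q21 q n.
Hypothesis hne : forall n, q21 q n <> -1.
Hypothesis hr : l1_near_pinfty q.
Hypothesis hl : l1_near_pinfty (refl_potential q).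

Variables (lam theta : R).
Hypothesis hth : quasimomentum m lam theta.

Variables (p p' : spinor).
Hypothesis hp : amplitude m lam theta p.
Hypothesis hp' : amplitude (- m) lam theta (swap p').

Let refl_sym : forall n, q12 (refl_potential q) n = q21 (refl_potential q) n.
Proof. intros n; simpl; now rewrite hsym. Qed.

Let refl_ne : forall n, q21 (refl_potential q) n <> -1.
Proof. intros n; simpl; rewrite hsym; apply hne. Qed.

Lemma solution_decaying_right (w : spinor_seq) :
  solution m q (RtoC lam) w -> decays w -> forall n, w n = vzero.
Proof.
  intros; apply (decaying_solution_zero m q lam theta); try assumption; now exists p.
Qed.

Lemma solution_decaying_left (w : spinor_seq) :
  solution m q (RtoC lam) w -> decays (refl w) -> forall n, w n = vzero.
Proof.
  intros sol dec; apply refl_eq_0.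
  apply (decaying_solution_zero (- m) (refl_potential q) lam theta); try assumption.
  - now apply quasimomentum_neg_mass.
  - now exists (swap p').
  - now apply -> solution_refl.
Qed.

Lemma solution_not_l2 (w : spinor_seq) :
  solution m q (RtoC lam) w -> (exists n, w n <> vzero) -> not_l2_near_infinities w.
Proof.
  intros sol [n hn]; split; intros h; apply hn.
  - now apply solution_decaying_right, decays_of_l2_near_pinfty.
  - now apply solution_decaying_left, decays_of_l2_near_pinfty, l2_near_minfty_refl.
Qed.

(* The fluxes of the two Jost solutions have opposite signs, so the Pluecker identity
   for both and their conjugates forbids a vanishing Wronskian. *)
Lemma jost_wronskian_neq_0 (wp wm : spinor_seq) :
  jost_right m q lam theta p wp -> jost_left m q lam theta p' wm ->
  wronskian wp wm 0 <> RtoC 0.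
Proof.
  intros jp jm W0.
  pose proof (proj1 (jost_left_refl _ _ _ _ _ _) jm) as jm'.
  pose proof (jost_right_flux _ _ _ _ _ _ 0 hsym hth hp jp) as fp.
  pose proof (jost_right_flux _ _ _ _ _ _ (- 0 - 1) refl_sym
    (quasimomentum_neg_mass _ _ _ hth) hp' jm') as fm.
  change (conjs (refl wm)) with (refl (conjs wm)) in fm.
  rewrite wronskian_refl in fm.
  (* The currents are i a for [wp] and, after the sign change under reflection, -i b for [wm]. If
     W(wp,wm) = 0, the relation becomes a b = -|W(wp, conj wm)|^2, against a b > 0. *)
  pose proof (wronskian_pluecker wp (conjs wp) wm (conjs wm) 0) as pl.
  assert (cc : conjs (conjs wm) = wm).
  { apply functional_extensionality; intros n; unfold conjs; cbn [fst snd].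
    rewrite !Cconj_conj; now rewrite <- surjective_pairing. }
  pose proof (wronskian_conjs wp (conjs wm) 0) as X; rewrite cc in X.
  rewrite X, <- Cmod2_conj, W0, fp in pl.
  set (x := Cmod (wronskian wp (conjs wm) 0)) in *.
  set (a := flux m lam theta p) in *; set (b := flux (- m) lam theta (swap p')) in *.
  assert (ab : 0 < a * b).
  { pose proof (quasimomentum_sin _ _ _ hth) as s0.
    pose proof (quasimomentum_pos _ _ _ hth) as pos.
    destruct hp as [_ [_ n1]], hp' as [_ [_ n2]].
    apply Cmod_gt_0 in n1, n2.
    assert (lam + m <> 0) by (intros e; rewrite e in *; lra).
    assert (lam - m <> 0) by (intros e; rewrite e in *; lra).
    (* The reflected flux has denominator lam - m, so the product of the fluxes carries sin^2 theta
       over (lam + m)(lam - m). *)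
    replace (a * b) with
      (4 * (sin theta * sin theta) * (Cmod (fst p) ^ 2 * Cmod (fst (swap p')) ^ 2)
       / ((lam + m) * (lam - m))).
    - apply Rdiv_lt_0_compat; [| exact pos].
      pose proof (pow_lt _ 2 n1); pose proof (pow_lt _ 2 n2).
      apply Rmult_lt_0_compat; [nra | now apply Rmult_lt_0_compat].
    - unfold a, b, flux; replace (lam + - m) with (lam - m) by ring; field; auto. }
  assert (pl' : RtoC (a * b) = RtoC (- x ^ 2)).
  { transitivity ((0, a) * wronskian wm (conjs wm) 0)%C.
    - replace (wronskian wm (conjs wm) 0) with (- (0, b))%C
        by (rewrite <- fm; ring).
      unfold RtoC, Cmult, Copp; simpl; f_equal; ring.
    - rewrite pl, RtoC_opp; ring. }
  injection pl' as pl'.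
  pose proof (pow2_ge_0 x); lra.
Qed.

(** The nonzero Wronskian gives the fundamental system and also shows that both solutions are
    nontrivial; a nontrivial solution decays at neither end, so it is square summable at neither. *)
Lemma jost_system :
  exists wp wm : spinor_seq,
    unique (jost_right m q lam theta p) wp /\
    unique (jost_left m q lam theta p') wm /\
    fundamental_system m q (RtoC lam) wp wm /\
    not_l2_near_infinities wp /\
    not_l2_near_infinities wm.
Proof.
  destruct (ex_jost_right m q lam theta p) as [wp jp]; try assumption.
  destruct (ex_jost_right (- m) (refl_potential q) lam theta (swap p')) as [rm jm'];
    try assumption; [now apply quasimomentum_neg_mass |].
  assert (rr : refl (refl rm) = rm).
  { apply functional_extensionality; intros n; unfold refl; cbn [fst snd].
    rewrite Z.opp_involutive; now rewrite <- surjective_pairing. }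
  set (wm := refl rm) in *.
  assert (jm : jost_left m q lam theta p' wm)
    by (apply jost_left_refl; now rewrite rr).
  pose proof (jost_wronskian_neq_0 wp wm jp jm) as W0.
  exists wp, wm; split; [| split; [| split; [| split]]].
  - split; [exact jp |].
    intros w [sol asy]; apply functional_extensionality; intros n; apply vsub_eq_0; revert n.
    apply (solution_decaying_right (fun n => vsub (wp n) (w n))).
    + apply solution_vsub; [apply jp | exact sol].
    + now apply (decays_vsub wp w (plane theta p)); [apply jp |].
  - split; [exact jm |].
    intros w jw; apply functional_extensionality; intros n; apply vsub_eq_0; revert n.
    apply (solution_decaying_left (fun n => vsub (wm n) (w n))).
    + apply solution_vsub; [apply jm | apply jw].
    + rewrite refl_vsub.
      apply (decays_vsub (refl wm) (refl w) (plane theta (swap p')));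
        apply (jost_left_refl m q lam theta p'); assumption.
  - apply (fundamental_of_wronskian m q (RtoC lam) wp wm hsym (proj1 jp) (proj1 jm) W0).
  - apply solution_not_l2; [apply jp | now apply wronskian_neq_0_nonzero in W0].
  - apply solution_not_l2; [apply jm |].
    apply (wronskian_neq_0_nonzero wm wp 0); rewrite wronskian_antisym.
    intros h; apply W0.
    transitivity (- - wronskian wp wm 0)%C; [ring | rewrite h; ring].
Qed.

End JostSystem.

Theorem mainTheorem4 (m : R) (q : potential)
  (hm : 0 < m)
  (hsym : forall n : Z, q12 q n = q21 q n)
  (hne : forall n : Z, q21 q n <> -1)
  (h11 : l1 (q11 q)) (h12 : l1 (q12 q)) (h21 : l1 (q21 q)) (h22 : l1 (q22 q)) :
  (forall lam : R, Gamma m lam -> ~ eigenvalue m q (RtoC lam)) /\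
  (forall lam theta : R, Gamma_neg m lam -> quasimomentum m lam theta ->
     exists wp wm : spinor_seq,
       unique (tjost_plus m q lam theta) wp /\
       unique (tjost_minus m q lam theta) wm /\
       fundamental_system m q (RtoC lam) wp wm /\
       not_l2_near_infinities wp /\
       not_l2_near_infinities wm) /\
  (forall lam theta : R, Gamma_pos m lam -> quasimomentum m lam theta ->
     exists wp wm : spinor_seq,
       unique (jost_plus m q lam theta) wp /\
       unique (jost_minus m q lam theta) wm /\
       fundamental_system m q (RtoC lam) wp wm /\
       not_l2_near_infinities wp /\
       not_l2_near_infinities wm).
Proof.
  assert (hr : l1_near_pinfty q)
    by (repeat split; [apply h11 | apply h12 | apply h21 | apply h22]).
  assert (hl : l1_near_pinfty (refl_potential q))
    by (repeat split; [apply h22 | apply h21 | apply h12 | apply h11]).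
  assert (factors : forall lam theta, quasimomentum m lam theta ->
    (RtoC lam + RtoC m)%C <> RtoC 0 /\ (RtoC lam - RtoC m)%C <> RtoC 0).
  { intros lam theta hth; pose proof (quasimomentum_pos _ _ _ hth).
    rewrite <- RtoC_plus, <- RtoC_minus.
    split; apply RtoC_neq_0; intros e; rewrite e in *; lra. }
  assert (amp : forall lam theta, quasimomentum m lam theta ->
    amplitude m lam theta (RtoC 1, alpha_plus m lam theta) /\
    amplitude (- m) lam theta (swap (RtoC 1, alpha_minus m lam theta))).
  { intros lam theta hth; destruct (factors _ _ hth) as [f1 f2].
    pose proof (quasimomentum_cis _ _ _ hth) as e.
    assert (f1' : (RtoC m + RtoC lam)%C <> RtoC 0) by (now rewrite Cplus_comm).
    unfold amplitude, swap, alpha_plus, alpha_minus; cbn [fst snd].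
    rewrite RtoC_plus, RtoC_opp; repeat split.
    - field; exact f1'.
    - transitivity ((1 - cis theta) * (1 - cis (- theta)) / (RtoC m + RtoC lam))%C;
        [rewrite e |]; field; exact f1'.
    - apply RtoC_neq_0, R1_neq_R0.
    - transitivity ((1 - cis theta) * (1 - cis (- theta)) / (RtoC m + RtoC lam))%C;
        [rewrite e |]; field; exact f1'.
    - field; exact f1'.
    - intros z.
      (* After the swap the first component is [alpha_minus]. If it vanished, so would (lam + m)(lam
         - m). *)
      assert (z' : ((1 - cis theta) * (1 - cis (- theta)))%C = RtoC 0).
      { transitivity ((1 - cis theta) * (RtoC m + RtoC lam)
          * ((1 - cis (- theta)) / (RtoC m + RtoC lam)))%C;
          [field; exact f1' | rewrite z; ring]. }
      rewrite e in z'; apply (Cmult_neq_0 _ _ f1 f2 z'). }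
  assert (tamp : forall lam theta, quasimomentum m lam theta ->
    amplitude m lam theta (talpha_plus m lam theta, RtoC 1) /\
    amplitude (- m) lam theta (swap (talpha_minus m lam theta, RtoC 1))).
  { intros lam theta hth; destruct (factors _ _ hth) as [f1 f2].
    pose proof (quasimomentum_cis _ _ _ hth) as e.
    unfold amplitude, swap, talpha_plus, talpha_minus; cbn [fst snd].
    rewrite RtoC_minus, RtoC_opp; repeat split.
    - transitivity ((1 - cis theta) * (1 - cis (- theta)) / (RtoC lam - RtoC m))%C;
        [rewrite e |]; field; exact f2.
    - field; exact f2.
    - intros z.
      assert (z' : ((1 - cis theta) * (1 - cis (- theta)))%C = RtoC 0).
      { transitivity ((1 - cis theta) * (RtoC lam - RtoC m)
          * ((1 - cis (- theta)) / (RtoC lam - RtoC m)))%C;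
          [field; exact f2 | rewrite z; ring]. }
      rewrite e in z'; apply (Cmult_neq_0 _ _ f1 f2 z').
    - field; exact f2.
    - transitivity ((1 - cis theta) * (1 - cis (- theta)) / (RtoC lam - RtoC m))%C;
        [rewrite e |]; field; exact f2.
    - apply RtoC_neq_0, R1_neq_R0. }
  split; [| split].
  - intros lam hG [w [[hw _] [nz sol]]].
    destruct (ex_quasimomentum m lam hm hG) as [theta hth].
    destruct (amp lam theta hth) as [hp hp'].
    destruct nz as [n hn]; apply hn.
    apply (decaying_solution_zero m q lam theta); try assumption.
    (* This amplitude serves on both bands, since lam + m is nonzero on each. *)
    + now exists (RtoC 1, alpha_plus m lam theta).
    + now apply decays_of_l2_near_pinfty.
  - intros lam theta _ hth; destruct (tamp lam theta hth) as [hp hp'].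
    exact (jost_system m q hsym hne hr hl lam theta hth _ _ hp hp').
  - intros lam theta _ hth; destruct (amp lam theta hth) as [hp hp'].
    exact (jost_system m q hsym hne hr hl lam theta hth _ _ hp hp').
Qed.
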